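(* Let $f=T_{a,b}$ be the Hénon map with $(a,b)\in\mathcal A$, and let $\mu$ be its SRB measure. Then there exists $\theta\in(0,1)$ such that for any $\varphi,\psi\in\mathcal C(\mathbb R^2)$ there is a constant $C$, depending on $\varphi$, $\psi$ and $f$, such that for all $n$ $$C_n(\varphi,\psi;\mu)\le 2(\|\varphi\|_\infty+\|\psi\|_\infty)\,\mathcal R_{\varphi,\psi}(\theta^n)+C\theta^n .$$
   Context: $T_{a,b}:\mathbb R^2\to\mathbb R^2$, $T_{a,b}(x,y)=(1-ax^2+y,\,bx)$. $\mathcal A$ denotes the positive Lebesgue measure set of parameters $(a,b)$ obtained by Benedicks–Carleson and Benedicks–Young: for every $(a,b)\in\mathcal A$ the map $T_{a,b}$ admits a unique SRB measure $\mu$ (supported on its compact attractor), $\mu$ is mixing, and correlations of Hölder continuous observables decay exponentially with respect to $\mu$ (this is known and may be taken as given). $\mathcal C(\mathbb R^2)$ is the space of continuous real-valued functions on $\mathbb R^2$. For $\varphi\in\mathcal C(\mathbb R^2)$, $\mathcal R_\varphi(\varepsilon)=\sup\{|\varphi(x)-\varphi(y)|:d(x,y)<\varepsilon\}$, and $\mathcal R_{\varphi,\psi}(\varepsilon)=\max\{\mathcal R_\varphi(\varepsilon),\mathcal R_\psi(\varepsilon)\}$. The correlation is $C_n(\varphi,\psi;\mu)=\left|\int(\varphi\circ f^n)\psi\,d\mu-\int\varphi\,d\mu\int\psi\,d\mu\right|$. Inequalities are vacuous when the right-hand side is infinite. *)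

(* Defs.v *)
From HB Require Import structures.
From mathcomp Require Import all_boot all_order all_algebra.
From mathcomp Require Import all_classical all_reals all_analysis.

Set Implicit Arguments.
Unset Strict Implicit.
Unset Printing Implicit Defensive.

Import Order.TTheory GRing.Theory Num.Theory.
Import numFieldNormedType.Exports.

Local Open Scope classical_set_scope.
Local Open Scope ring_scope.

Section Plane.
Context {R : realType}.
Implicit Types (x y v : R * R) (phi psi : R * R -> R) (f : R * R -> R * R).
Implicit Types mu : probability (R * R)%type R.

Definition henon (a b : R) : R * R -> R * R :=
  fun p => (1 - a * p.1 ^+ 2 + p.2, b * p.1).

(* The library norm on [R * R] is the max norm; these are Euclidean. *)
Definition enorm v : R := Num.sqrt (v.1 ^+ 2 + v.2 ^+ 2).

Definition edist x y : R := enorm (x - y).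

(** Observables *)

Definition sup_norm phi : \bar R := ereal_sup (range (fun x => `|phi x|%:E)).

Definition modulus phi (eps : R) : \bar R :=
  ereal_sup [set `|phi p.1 - phi p.2|%:E | p in
             [set p : (R * R) * (R * R) | edist p.1 p.2 < eps]].

Definition modulus2 phi psi (eps : R) : \bar R :=
  Order.max (modulus phi eps) (modulus psi eps).

Definition holder (eta : R) phi : Prop :=
  exists L : R, forall x y, `|phi x - phi y| <= L * edist x y `^ eta.

Definition correlation f mu (n : nat) phi psi : R :=
  `| \int[mu]_x (phi (iter n f x) * psi x)
     - (\int[mu]_x phi x) * (\int[mu]_x psi x) |.

(** Invariant measures *)

Definition invariant f mu : Prop :=
  measurable_fun setT f /\
  forall B : set (R * R), measurable B -> mu (f @^-1` B) = mu B.

Definition mixing f mu : Prop :=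
  forall B C : set (R * R), measurable B -> measurable C ->
    mu (iter n f @^-1` B `&` C) @[n --> \oo] --> (mu B * mu C)%E.

(* The rate depends only on the Hoelder exponent, the constant on the two
   observables. *)
Definition holder_exp_decay f mu : Prop :=
  forall eta : R, 0 < eta <= 1 ->
  exists tau : R, 0 < tau < 1 /\
    forall phi psi, holder eta phi -> holder eta psi ->
    exists K : R, forall n : nat, correlation f mu n phi psi <= K * tau ^+ n.

Definition attractor f (K : set (R * R)) : Prop :=
  [/\ compact K, K !=set0, f @` K = K &
      exists U : set (R * R), [/\ open U, K `<=` U &
        forall x, U x ->
          ereal_inf [set (edist (iter n f x) y)%:E | y in K]
            @[n --> \oo] --> 0%E]].

(** SRB measures *)

Definition backward_orbit f x (s : nat -> R * R) : Prop :=
  s 0%N = x /\ forall n, f (s n.+1) = s n.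

(* W^u(x): the points whose backward orbit is exponentially asymptotic to that
   of x.  For an invertible f the sequences are the iterates of its inverse. *)
Definition unstable_set f x : set (R * R) :=
  [set y | exists xs ys : nat -> R * R,
     [/\ backward_orbit f x xs, backward_orbit f y ys &
         (limn_esup (fun n => (n%:R^-1)%:E * lne (edist (xs n) (ys n))%:E)
            < 0)%E]].

Definition unstable_leaf f x (g : R -> R * R) : Prop :=
  [/\ injective g, range g = unstable_set f x, forall t, derivable g t 1,
      continuous (derive1 g) & forall t, derive1 g t != 0].

Definition arclength (g : R -> R * R) (N : set (R * R)) : \bar R :=
  (\int[lebesgue_measure]_(t in g @^-1` N) (enorm (derive1 g t))%:E)%E.

Definition positive_exponent f x : Prop :=
  exists v (lam : R), 0 < lam /\
    ((n%:R^-1)%:E * lne (enorm ('D_v (iter n f) x))%:E)%E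
      @[n --> \oo] --> lam%:E.

(* A measurable partition is encoded by a measurable function p : its elements
   are the fibers of p.  It is subordinate to the unstable manifolds if, for
   almost every x, the element of x lies in W^u(x) and contains a neighbourhood
   of x in W^u(x). *)
Definition subordinate f mu (p : R * R -> R) : Prop :=
  measurable_fun setT p /\
  {ae mu, forall x, exists g t,
     [/\ unstable_leaf f x g, g t = x,
         p @^-1` [set p x] `<=` unstable_set f x &
         \forall s \near t, p (g s) = p x]}.

Definition conditional_measures mu (p : R * R -> R)
    (k : R.-pker R ~> (R * R)%type) : Prop :=
  (forall (B : set (R * R)) (D : set R), measurable B -> measurable D ->
     mu (B `&` p @^-1` D) = (\int[mu]_(x in p @^-1` D) k (p x) B)%E) /\
  {ae mu, forall x, k (p x) (p @^-1` [set p x]) = 1%E}.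

Definition SRB f mu : Prop :=
  [/\ invariant f mu,
      {ae mu, forall x, positive_exponent f x},
      {ae mu, forall x, exists g, unstable_leaf f x g} &
      forall (p : R * R -> R) (k : R.-pker R ~> (R * R)%type),
        subordinate f mu p -> conditional_measures mu p k ->
        {ae mu, forall x, forall g, unstable_leaf f x g ->
           forall N : set (R * R), measurable N ->
             arclength g N = 0%E -> k (p x) N = 0%E}].

(** Parameters *)

(* The properties of the Benedicks-Carleson parameter set used as known facts.
   Measurability in [R * R] is Borel measurability; a Lebesgue measurable set
   has positive measure iff it contains a Borel set of positive measure. *)
Definition benedicks_young_parameters (A : set (R * R)) : Prop :=
  (exists B : set (R * R), [/\ measurable B, B `<=` A &
     (0 < (@lebesgue_measure R \x @lebesgue_measure R) B)%E]) /\
  forall a b : R, A (a, b) ->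
    let f := henon a b in
    [/\ exists mu, SRB f mu,
        forall mu nu : probability (R * R)%type R, SRB f mu -> SRB f nu ->
          forall B : set (R * R), measurable B -> mu B = nu B &
        forall mu, SRB f mu ->
          [/\ exists2 K, attractor f K & mu K = 1%E,
              mixing f mu & holder_exp_decay f mu]].

End Plane.

(* Main.v *)
(** Regularise [phi] and [psi] at scale [theta ^+ n] by infimal convolution: this
    keeps the sup norms, moves the observables by at most their moduli of
    continuity at [theta ^+ n], and yields Lipschitz observables with constant of
    order [theta ^- n]. The decay of correlations of the regularised pair would
    conclude, except that its constant is only known to exist for each pair of
    observables. A Baire argument over subseries of the weighted sums of all
    regularised observables makes it uniform, at the price of a factor
    [theta ^- (4 * n)]; this is absorbed by taking [theta ^+ 5] equal to the rate
    for Lipschitz observables. If an observable is unbounded it is not constant,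
    so its modulus is positive and the right-hand side is infinite. *)

Require Import Defs.
From HB Require Import structures.
From mathcomp Require Import all_boot all_order all_algebra.
From mathcomp Require Import all_classical all_reals all_analysis.
From mathcomp Require Import measurable_realfun.
From mathcomp Require Import ring lra.
Import Order.TTheory GRing.Theory Num.Theory.
Import numFieldNormedType.Exports.
Local Open Scope classical_set_scope.
Local Open Scope ring_scope.

(* The library exports another [edist]. *)
Local Notation edist := Defs.edist.

(** * Covariance of bounded measurable functions *)

Section covariance.
Context {d : measure_display} {T : measurableType d} {R : realType}.
Variable mu : probability T R.
Implicit Types (F G : T -> R) (A B c r : R).

Definition bounded_measurable A F :=
  measurable_fun setT F /\ forall x, `|F x| <= A.

(** The signed form of the correlation, kept without absolute value so that bilinearity is
    available. *)
Definition cov F G : R :=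
  \int[mu]_x (F x * G x) - (\int[mu]_x F x) * (\int[mu]_x G x).

Lemma bounded_measurable_integrable A F :
  bounded_measurable A F -> mu.-integrable setT (EFin \o F).
Proof.
move=> [mF bF]; apply: measurable_bounded_integrable => //.
  by rewrite -ge0_fin_numE// fin_num_measure.
exists A; split; first exact: num_real.
by move=> x Ax y _; exact: le_trans (bF y) (ltW Ax).
Qed.

Lemma bounded_measurableM A B F G : bounded_measurable A F ->
  bounded_measurable B G -> bounded_measurable (A * B) (fun x => F x * G x).
Proof.
move=> [mF bF] [mG bG]; split; first exact: measurable_funM.
by move=> x; rewrite normrM ler_pM.
Qed.

Lemma bounded_measurableB A B F G : bounded_measurable A F ->
  bounded_measurable B G -> bounded_measurable (A + B) (fun x => F x - G x).
Proof.
move=> [mF bF] [mG bG]; split; first exact: measurable_funB.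
by move=> x; rewrite (le_trans (ler_normB _ _))// lerD.
Qed.

Lemma bounded_measurableZ A c F : bounded_measurable A F ->
  bounded_measurable (`|c| * A) (fun x => c * F x).
Proof.
by move=> bF; apply: bounded_measurableM.
Qed.

Lemma bounded_measurable_comp A F (g : T -> T) : measurable_fun setT g ->
  bounded_measurable A F -> bounded_measurable A (F \o g).
Proof. by move=> mg [mF bF]; split => [|x]; [exact: measurableT_comp|exact: bF]. Qed.

Lemma normr_Rintegral_le A F :
  bounded_measurable A F -> `|\int[mu]_x F x| <= A.
Proof.
move=> bF; have iF := bounded_measurable_integrable _ _ bF.
apply: (le_trans (le_normr_Rintegral measurableT iF)).
have bA : bounded_measurable A (cst A).
  split => [|x]; first exact: measurable_cst.
  by rewrite ger0_norm// (le_trans _ (bF.2 x)).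
have bnF : bounded_measurable A (fun x => `|F x|).
  by split => [|x]; [exact: measurableT_comp bF.1|rewrite normr_id bF.2].
apply: (@le_trans _ _ (\int[mu]_x cst A x)).
  apply: le_Rintegral => //.
  - exact: bounded_measurable_integrable bnF.
  - exact: bounded_measurable_integrable bA.
  - by move=> x _; exact: bF.2.
by rewrite Rintegral_cst// [X in fine X]probability_setT mulr1.
Qed.

Lemma covC F G : cov F G = cov G F.
Proof.
rewrite /cov [X in _ - X]mulrC; congr (_ - _).
by apply: eq_Rintegral => x _; rewrite mulrC.
Qed.

Lemma covBl A A' B F F' G : bounded_measurable A F ->
  bounded_measurable A' F' -> bounded_measurable B G ->
  cov (fun x => F x - F' x) G = cov F G - cov F' G.
Proof.
move=> bF bF' bG; rewrite /cov RintegralB//; last 2 first.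
- exact: bounded_measurable_integrable bF.
- exact: bounded_measurable_integrable bF'.
under eq_Rintegral do rewrite mulrBl.
rewrite RintegralB//; first by ring.
- exact: bounded_measurable_integrable (bounded_measurableM _ _ _ _ bF bG).
- exact: bounded_measurable_integrable (bounded_measurableM _ _ _ _ bF' bG).
Qed.

Lemma covBr A B B' F G G' : bounded_measurable A F ->
  bounded_measurable B G -> bounded_measurable B' G' ->
  cov F (fun x => G x - G' x) = cov F G - cov F G'.
Proof. by move=> bF bG bG'; rewrite covC (covBl _ _ _ _ _ _ bG bG' bF) !(covC F). Qed.

Lemma covZl A B c F G : bounded_measurable A F -> bounded_measurable B G ->
  cov (fun x => c * F x) G = c * cov F G.
Proof.
move=> bF bG; rewrite /cov RintegralZl//; last first.
  exact: bounded_measurable_integrable bF.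
under eq_Rintegral do rewrite -mulrA.
rewrite RintegralZl//; first by ring.
exact: bounded_measurable_integrable (bounded_measurableM _ _ _ _ bF bG).
Qed.

Lemma covZr A B c F G : bounded_measurable A F -> bounded_measurable B G ->
  cov F (fun x => c * G x) = c * cov F G.
Proof. by move=> bF bG; rewrite covC (covZl _ _ _ _ _ bG bF) covC. Qed.

Lemma normr_cov_le A B F G : bounded_measurable A F ->
  bounded_measurable B G -> `|cov F G| <= 2 * A * B.
Proof.
move=> bF bG; rewrite /cov (le_trans (ler_normB _ _))//.
rewrite -mulrA mulrDl mul1r lerD// ?normrM.
  exact: normr_Rintegral_le (bounded_measurableM _ _ _ _ bF bG).
by rewrite ler_pM// normr_Rintegral_le.
Qed.

(** The two functions are exchanged one after the other; each exchange leaves a covariance with one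
    factor bounded by [r]. This is the source of the factor [2 * (A + B)] in the theorem. *)
Lemma cov_close A B r F F' G G' :
  bounded_measurable A F -> bounded_measurable A F' ->
  bounded_measurable B G -> bounded_measurable B G' ->
  (forall x, `|F x - F' x| <= r) -> (forall x, `|G x - G' x| <= r) ->
  `|cov F G - cov F' G'| <= 2 * (A + B) * r.
Proof.
move=> bF bF' bG bG' dF dG.
have bdF : bounded_measurable r (fun x => F x - F' x).
  by split => //; exact: (bounded_measurableB _ _ _ _ bF bF').1.
have bdG : bounded_measurable r (fun x => G x - G' x).
  by split => //; exact: (bounded_measurableB _ _ _ _ bG bG').1.
have -> : cov F G - cov F' G' =
    cov (fun x => F x - F' x) G + cov F' (fun x => G x - G' x).
  by rewrite (covBl _ _ _ _ _ _ bF bF' bG) (covBr _ _ _ _ _ _ bF' bG bG'); ring.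
apply: (le_trans (ler_normD _ _)).
have -> : 2 * (A + B) * r = 2 * r * B + 2 * A * r by ring.
by rewrite lerD// normr_cov_le.
Qed.

End covariance.

(** * Euclidean distance, Lipschitz functions and Borel sets of the plane *)

Section euclidean_plane.
Context {R : realType}.
Implicit Types (x y z v w : R * R) (phi : R * R -> R) (L e : R).

Lemma enormD v w : enorm (v + w) <= enorm v + enorm w.
Proof.
rewrite /enorm; case: v => a b; case: w => c e /=.
set X := Num.sqrt (a ^+ 2 + _); set Y := Num.sqrt (c ^+ 2 + _).
have X0 : 0 <= X by exact: sqrtr_ge0.
have Y0 : 0 <= Y by exact: sqrtr_ge0.
have X2 : X ^+ 2 = a ^+ 2 + b ^+ 2 by rewrite sqr_sqrtr// addr_ge0// sqr_ge0.
have Y2 : Y ^+ 2 = c ^+ 2 + e ^+ 2 by rewrite sqr_sqrtr// addr_ge0// sqr_ge0.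
have CS : a * c + b * e <= X * Y.
  apply: (le_trans (ler_norm _)); rewrite -(@ler_pXn2r _ 2)// ?nnegrE ?mulr_ge0//.
  rewrite real_normK ?num_real// exprMn X2 Y2 -subr_ge0.
  (* Lagrange's identity, which yields Cauchy-Schwarz. *)
  suff -> : (a ^+ 2 + b ^+ 2) * (c ^+ 2 + e ^+ 2) - (a * c + b * e) ^+ 2 =
    (a * e - b * c) ^+ 2 by exact: sqr_ge0.
  by ring.
rewrite -(@ler_pXn2r _ 2)// ?nnegrE ?addr_ge0// ?sqrtr_ge0//.
rewrite sqr_sqrtr ?addr_ge0 ?sqr_ge0//.
have -> : (X + Y) ^+ 2 = X ^+ 2 + Y ^+ 2 + 2 * (X * Y) by ring.
by rewrite X2 Y2; lra.
Qed.

Lemma edist_ge0 x y : 0 <= edist x y.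
Proof. exact: sqrtr_ge0. Qed.

Lemma edistxx x : edist x x = 0.
Proof. by rewrite /edist /enorm subrr /= expr0n addr0 sqrtr0. Qed.

Lemma edistC x y : edist x y = edist y x.
Proof. by rewrite /edist /enorm /=; congr Num.sqrt; ring. Qed.

Lemma edist_triangle y x z : edist x z <= edist x y + edist y z.
Proof.
by rewrite /edist (_ : x - z = (x - y) + (y - z)) ?enormD// addrA subrK.
Qed.

(** Links the Euclidean distance to the coordinatewise balls that define the topology of the
    product. *)
Lemma edist_le_sum x y : edist x y <= `|x.1 - y.1| + `|x.2 - y.2|.
Proof.
rewrite /edist /enorm /= -(@ler_pXn2r _ 2)// ?nnegrE ?sqrtr_ge0 ?addr_ge0//.
rewrite sqr_sqrtr ?addr_ge0 ?sqr_ge0// [leRHS]sqrrD !real_normK ?num_real//.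
by rewrite lerD2r lerDl mulrn_wge0// mulr_ge0.
Qed.

Definition elipschitz L phi := forall x y, `|phi x - phi y| <= L * edist x y.

Lemma elipschitz_holder1 L phi : elipschitz L phi -> holder 1 phi.
Proof.
by move=> lip; exists L => x y; rewrite powRr1 ?edist_ge0//; exact: lip.
Qed.

Lemma elipschitz_continuous L phi : elipschitz L phi -> continuous phi.
Proof.
move=> lip x; apply/cvgrPdist_lt => e e0.
have L0 : 0 < `|L| + 1 by rewrite ltr_pwDr.
(* The factor 2 shares [e] between the two coordinates; the added 1 keeps the denominator positive
   when [L] is zero. *)
have d0 : 0 < e / (2 * (`|L| + 1)) by rewrite divr_gt0// mulr_gt0.
exists (ball x.1 (e / (2 * (`|L| + 1))), ball x.2 (e / (2 * (`|L| + 1)))) => /=.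
  by split; exact: nbhsx_ballx.
move=> y [/= y1 y2]; apply: le_lt_trans (lip _ _) _.
apply: (@le_lt_trans _ _ (`|L| * edist x y)).
  by rewrite ler_wpM2r ?edist_ge0// ler_norm.
apply: (@le_lt_trans _ _ ((`|L| + 1) * edist x y)).
  by rewrite ler_wpM2r ?edist_ge0// lerDl.
rewrite mulrC -ltr_pdivlMr//; apply: (le_lt_trans (edist_le_sum _ _)).
have -> : e / (`|L| + 1) = e / (2 * (`|L| + 1)) + e / (2 * (`|L| + 1)).
  by field; rewrite gt_eqF.
by rewrite ltrD.
Qed.

(* An open subset of the plane is a countable union of balls of the product
   metric with rational centre and radius; these are boxes, hence measurable. *)
Lemma open_measurable_prod (U : set (R * R)) : open U -> measurable U.
Proof.
move=> oU.
pose box (q p r : rat) : set (R * R) :=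
  ball (ratr q : R) (ratr r : R) `*` ball (ratr p : R) (ratr r : R).
pose F (q p r : rat) : set (R * R) :=
  if pselect (box q p r `<=` U) is left _ then box q p r else set0.
have -> : U = \bigcup_q \bigcup_p \bigcup_r F q p r.
  apply/seteqP; split => [x Ux|x [q _] [p _] [r _]]; last first.
    by rewrite /F; case: pselect => [sub ?|//]; exact: sub.
  have [[B1 B2] /= [nB1 nB2] BU] := open_nbhs_nbhs (conj oU Ux).
  have /nbhs_ballP[e1 /= e10 he1] := nB1.
  have /nbhs_ballP[e2 /= e20 he2] := nB2.
  (* With [2 * r] at most [e1] and [e2], a box of radius [r] that contains [x] stays inside the
     given neighbourhood of [x]. *)
  have [r /itvP r0] : exists q, ratr q \in `]0, (Num.min e1 e2 / 2)[.
    by apply: rat_in_itvoo; rewrite divr_gt0// lt_min e10.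
  have near_rat (t : R) : exists q : rat, `|ratr q - t| < ratr r.
    have [|q /itvP hq] := @rat_in_itvoo _ (t - ratr r) (t + ratr r).
      by rewrite ltrBlDr -addrA ltrDl addr_gt0// r0.
    by exists q; rewrite ltr_distl !hq.
  have [q hq] := near_rat x.1; have [p hp] := near_rat x.2.
  have re : ratr r < Num.min e1 e2 / 2 by rewrite r0.
  have re1 : ratr r + ratr r <= e1.
    have : Num.min e1 e2 <= e1 by rewrite ge_min lexx.
    lra.
  have re2 : ratr r + ratr r <= e2.
    have : Num.min e1 e2 <= e2 by rewrite ge_min lexx orbT.
    lra.
  exists q => //; exists p => //; exists r => //.
  rewrite /F; case: pselect => [_|[]]; first by split.
  move=> y [y1 y2]; apply: BU; split; [apply: he1|apply: he2].
    by apply: (le_ball re1); apply: (ball_triangle _ y1); exact: ball_sym.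
  by apply: (le_ball re2); apply: (ball_triangle _ y2); exact: ball_sym.
apply: bigcupT_measurable_rat => q; apply: bigcupT_measurable_rat => p.
apply: bigcupT_measurable_rat => r; rewrite /F; case: pselect => // _.
by apply: measurableX; exact: measurable_ball.
Qed.

Lemma continuous_measurable_prod phi : continuous phi -> measurable_fun setT phi.
Proof.
move=> /continuousP cphi; apply: (measurability _ (RGenOpens.measurableE R)).
move=> _ [_ [a [b ->] <-]]; rewrite setTI; apply: open_measurable_prod.
exact/cphi/interval_open.
Qed.

End euclidean_plane.

(** * Lipschitz regularisation by infimal convolution *)

Section inf_convolution.
Context {R : realType}.
Implicit Types (phi psi : R * R -> R).

(* The infimal convolution of [phi] with [2 * M / delta * edist]: a point at
   distance at least [delta] costs at least [2 * M] and so cannot compete. *)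
Lemma lipschitz_approximation (M delta : R) phi : 0 < delta ->
  (forall x, `|phi x| <= M) ->
  exists psi, [/\ forall x, `|psi x| <= M, elipschitz (2 * M / delta) psi &
    forall r, (forall x y, edist x y < delta -> `|phi x - phi y| <= r) ->
      forall x, `|phi x - psi x| <= r].
Proof.
move=> d0 bphi; set L := 2 * M / delta.
have M0 : 0 <= M by exact: le_trans (bphi (0, 0)).
have L0 : 0 <= L by rewrite divr_ge0 ?mulr_ge0// ltW.
pose S x := [set phi y + L * edist x y | y in [set: R * R]].
have S0 x : S x !=set0 by exists (phi x + L * edist x x), x.
have SM x : lbound (S x) (- M).
  move=> _ [y _ <-]; have := bphi y; rewrite ler_norml => /andP[+ _].
  by move/le_trans; apply; rewrite lerDl mulr_ge0// edist_ge0.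
have le_S x y : inf (S x) <= phi y + L * edist x y.
  by apply: ge_inf; [exists (- M)|exists y].
have S_le x : inf (S x) <= phi x.
  by have := le_S x x; rewrite edistxx mulr0 addr0.
exists (fun x => inf (S x)); split.
- move=> x; rewrite ler_norml lb_le_inf//= (le_trans (S_le x))//.
  by rewrite (le_trans (ler_norm _)).
- have half x z : inf (S x) - L * edist x z <= inf (S z).
    apply: lb_le_inf => // _ [y _ <-].
    rewrite lerBlDr (le_trans (le_S x y))// -addrA lerD2l -mulrDr ler_wpM2l//.
    by rewrite addrC edist_triangle.
  move=> x z; rewrite ler_norml; have := half x z; have := half z x.
  by rewrite (edistC z x); lra.
- move=> r hr x; have r0 : 0 <= r.
    by have := hr x x; rewrite edistxx subrr normr0; exact.
  rewrite ger0_norm ?subr_ge0// lerBlDl -lerBlDr.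
  apply: lb_le_inf => // _ [y _ <-].
  (* A near competitor loses at most [r] against [phi x]; a far one has value at least
     [- M + 2 * M], which is at least [phi x]. *)
  have [xy|xy] := ltP (edist x y) delta.
    have := hr _ _ xy; rewrite ler_norml => /andP[_].
    have : 0 <= L * edist x y by rewrite mulr_ge0// edist_ge0.
    lra.
  have : 2 * M <= L * edist x y.
    by rewrite /L mulrAC ler_pdivlMr// ler_wpM2l// mulr_ge0.
  have := bphi x; have := bphi y; rewrite !ler_norml => /andP[? ?] /andP[? ?].
  lra.
Qed.

End inf_convolution.

(** * Series dominated by geometric series *)

Section geometric_domination.
Context {R : realType}.
Implicit Types (u v : nat -> R) (c q : R).

Lemma cvg_series_geometric_dominated c q u : 0 <= q < 1 ->
  (forall k, `|u k| <= c * q ^+ k) -> cvgn [normed series u].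
Proof.
move=> /andP[q0 q1] hu.
apply: (series_le_cvg (v_ := geometric c q)) => //.
- by move=> n /=; exact: normr_ge0.
- by move=> n /=; exact: le_trans (normr_ge0 _) (hu n).
- by apply: is_cvg_geometric_series; rewrite ger0_norm.
Qed.

Lemma normr_lim_series_le c q u : 0 <= q < 1 ->
  (forall k, `|u k| <= c * q ^+ k) -> `|limn (series u)| <= c / (1 - q).
Proof.
move=> q01 hu; have cu := cvg_series_geometric_dominated _ _ _ q01 hu.
apply: (le_trans (lim_series_norm cu)).
have q1 : `|q| < 1 by case/andP: q01 => ? ?; rewrite ger0_norm.
rewrite -(cvg_lim _ (cvg_geometric_series (a := c) q1))//.
by apply: lim_series_le => //; exact: is_cvg_geometric_series.
Qed.

Lemma normr_lim_seriesB_le c c' q u v : 0 <= q < 1 ->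
  (forall k, `|u k| <= c' * q ^+ k) -> (forall k, `|v k| <= c' * q ^+ k) ->
  (forall k, `|u k - v k| <= c * q ^+ k) ->
  `|limn (series u) - limn (series v)| <= c / (1 - q).
Proof.
move=> q01 hu hv huv; rewrite -lim_seriesB.
- exact: normr_lim_series_le.
- exact: normed_cvg (cvg_series_geometric_dominated _ _ _ q01 hu).
- exact: normed_cvg (cvg_series_geometric_dominated _ _ _ q01 hv).
Qed.

Lemma lim_series_single (k : nat) (w : R) u :
  (forall j, u j = if j == k then w else 0) -> limn (series u) = w.
Proof.
move=> hu; apply/cvg_lim => //; apply: cvg_near_cst.
exists k.+1 => // n /= kn; rewrite /series /=.
rewrite (bigD1_seq k)//= ?mem_index_iota ?iota_uniq//.
by rewrite hu eqxx big1 ?addr0// => j /negbTE jk; rewrite hu jk.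
Qed.

End geometric_domination.

(* Baire's theorem for the sets [bad K], open in the product topology of the
   discrete space [T], with nested cylinders built by hand. *)
Lemma cylinder_baire (T : Type) (t0 : T) (bad : nat -> (nat -> T) -> Prop) :
  (forall K s, bad K s -> exists N, forall s',
     (forall i, (i < N)%N -> s' i = s i) -> bad K s') ->
  (forall s, exists K, ~ bad K s) ->
  exists K N w, forall s, (forall i, (i < N)%N -> s i = w i) -> ~ bad K s.
Proof.
move=> bad_open not_bad; apply: contrapT => no_cylinder.
(* A state is a sequence with the length of the prefix that counts. As no cylinder avoids [bad K],
   each one contains a longer cylinder lying inside [bad K]. *)
have step (a : nat * ((nat -> T) * nat)) : exists b : (nat -> T) * nat,
    [/\ (a.2.2 < b.2)%N, forall i, (i < a.2.2)%N -> b.1 i = a.2.1 i &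
        forall s, (forall i, (i < b.2)%N -> s i = b.1 i) -> bad a.1 s].
  case: a => K [w N] /=; have [s [sw bs]] : exists s,
      (forall i, (i < N)%N -> s i = w i) /\ bad K s.
    apply: contrapT => h; apply: no_cylinder; exists K, N, w => s sw bs.
    by apply: h; exists s.
  have [N' hN'] := bad_open _ _ bs.
  (* [N.+1] makes the prefix strictly longer, [N'] places the cylinder inside [bad K]. *)
  exists (s, maxn N.+1 N') => /=; split => //; first by rewrite leq_max leqnn.
  by move=> s' s's; apply: hN' => i iN; apply: s's; rewrite leq_max iN orbT.
have [next nextP] := choice step.
pose sigma := fix sigma k := if k is j.+1 then next (j, sigma j)
  else (fun=> t0, 0%N).
have sigmaS k : sigma k.+1 = next (k, sigma k) by [].
have sigma_ge k : (k <= (sigma k).2)%N.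
  elim: k => // k /leq_ltn_trans; apply.
  by rewrite sigmaS; case: (nextP (k, sigma k)).
have agree k m i : (i < (sigma k).2)%N -> (sigma (k + m)%N).1 i = (sigma k).1 i.
  elim: m k => [k|m IH k] ik; first by rewrite addn0.
  rewrite addnS -addSn; have [lt_k eq_k _] := nextP (k, sigma k).
  by rewrite IH sigmaS ?eq_k// (ltn_trans ik).
(* Diagonal limit: by [sigma_ge], digit [i] is already frozen at stage [i.+1]. So [s] lies in all
   the cylinders and is bad for every [K]. *)
pose s i := (sigma i.+1).1 i.
have s_agree k i : (i < (sigma k).2)%N -> s i = (sigma k).1 i.
  rewrite /s => ik; have [ki|ki] := leqP k i.+1.
    by rewrite -(subnKC ki) agree.
  by rewrite -(subnKC (ltnW ki)) agree// sigma_ge.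
have [K] := not_bad s; apply.
have [_ _] := nextP (K, sigma K); apply => i.
by rewrite -sigmaS; exact: s_agree.
Qed.

(** * Weighted subseries of a sequence of observables *)

Section subseries.
Context {R : realType}.
Variables (theta M L : R) (phi_ : nat -> R * R -> R).
Hypothesis theta01 : 0 < theta < 1.
Hypothesis phi_le : forall k x, `|phi_ k x| <= M.
Hypothesis phi_lip : forall k, elipschitz (L / theta ^+ k) (phi_ k).
Implicit Types (s : nat -> bool) (x y : R * R).

(** The digits [s] select terms. One factor [theta ^+ k] cancels the growth of the Lipschitz
    constant of [phi_ k], the other makes the series converge, so every subseries is bounded and
    Lipschitz. *)
Definition subseries_term s x (k : nat) : R :=
  (s k)%:R * (theta ^+ k * theta ^+ k * phi_ k x).

Definition subseries s x : R := limn (series (subseries_term s x)).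

Let theta0 : 0 < theta. Proof. by case/andP: theta01. Qed.

Let theta1 : theta < 1. Proof. by case/andP: theta01. Qed.

Let theta01' : 0 <= theta < 1. Proof. by rewrite ltW. Qed.

Let M0 : 0 <= M. Proof. exact: le_trans (phi_le 0 0). Qed.

Let thetaX_le1 k : theta ^+ k <= 1.
Proof. by rewrite exprn_ile1// ltW. Qed.

Let normr_weight_le k x : `|theta ^+ k * theta ^+ k * phi_ k x| <= M * theta ^+ k.
Proof.
have tk : 0 < theta ^+ k by rewrite exprn_gt0.
rewrite !normrM (gtr0_norm tk) -mulrA mulrC ler_pM2r// -[leRHS]mul1r.
by rewrite ler_pM// ltW.
Qed.

Let normr_term_le s x k : `|subseries_term s x k| <= M * theta ^+ k.
Proof.
rewrite /subseries_term; case: (s k); rewrite ?mul1r ?mul0r ?normr0//.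
by rewrite mulr_ge0// exprn_ge0// ltW.
Qed.

Lemma normr_subseries_le s x : `|subseries s x| <= M / (1 - theta).
Proof. by apply: normr_lim_series_le. Qed.

Lemma subseries_elipschitz s : elipschitz (L / (1 - theta)) (subseries s).
Proof.
move=> x y; rewrite mulrAC; apply: normr_lim_seriesB_le => // k.
have tk : 0 < theta ^+ k by rewrite exprn_gt0.
have Lxy := phi_lip k x y.
(* No sign of [L] is assumed; the product is nonnegative because, up to a positive factor, it bounds
   an absolute value. *)
have L0 : 0 <= L * edist x y.
  have -> : L * edist x y = L / theta ^+ k * edist x y * theta ^+ k.
    by field; rewrite expf_neq0// gt_eqF.
  by rewrite mulr_ge0 ?(le_trans _ Lxy)// ltW.
rewrite /subseries_term; case: (s k); last first.
  by rewrite !mul0r subrr normr0 mulr_ge0// ltW.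
rewrite !mul1r -mulrBr !normrM (gtr0_norm tk) -mulrA mulrC ler_pM2r//.
rewrite -ler_pdivlMl// (le_trans Lxy)//.
by rewrite mulrAC mulrC.
Qed.

(** Terms before [N] cancel; later, one factor of the weight is at most [theta ^+ N] and the other
    is summed. This continuity in the digits makes the Baire sets open. *)
Lemma subseries_close s s' N x : (forall i, (i < N)%N -> s i = s' i) ->
  `|subseries s x - subseries s' x| <= M * theta ^+ N / (1 - theta).
Proof.
move=> ss'; apply: normr_lim_seriesB_le => // k.
have tk j : 0 < theta ^+ j by rewrite exprn_gt0.
rewrite /subseries_term -mulrBl; have [kN|Nk] := ltnP k N.
  rewrite ss'// subrr mul0r normr0 mulr_ge0//; last exact: ltW.
  by rewrite mulr_ge0// ltW.
have b1 : `|(s k)%:R - (s' k)%:R : R| <= 1.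
  by case: (s k); case: (s' k); rewrite ?subrr ?subr0 ?sub0r ?normrN ?normr0 ?normr1.
rewrite normrM -[leRHS]mul1r ler_pM// !normrM (gtr0_norm (tk k)) mulrAC.
rewrite ler_pM2r// mulrC ler_pM ?(ltW (tk k))//.
by rewrite ler_wiXn2l// ltW.
Qed.

(** Recovers a single observable from two subseries, at the price of its weight
    [theta ^+ (2 * k)]. *)
Lemma subseries_flip s s' k x : s k -> ~~ s' k ->
  (forall j, j != k -> s j = s' j) ->
  theta ^+ k * theta ^+ k * phi_ k x = subseries s x - subseries s' x.
Proof.
move=> sk s'k ss'; rewrite /subseries -lim_seriesB.
- apply/esym/(lim_series_single k) => j; rewrite !fctE /subseries_term -mulrBl.
  case: eqP => [->|/eqP jk]; first by rewrite sk (negbTE s'k) subr0 mul1r.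
  by rewrite ss'// subrr mul0r.
- exact: normed_cvg (cvg_series_geometric_dominated _ _ _ theta01' (normr_term_le s x)).
- exact: normed_cvg (cvg_series_geometric_dominated _ _ _ theta01' (normr_term_le s' x)).
Qed.

Lemma subseries_bounded_measurable s :
  bounded_measurable (M / (1 - theta)) (subseries s).
Proof.
split; last exact: normr_subseries_le.
apply: continuous_measurable_prod.
exact: elipschitz_continuous (subseries_elipschitz s).
Qed.

End subseries.

(** * Correlations under an invariant measure *)

Section invariant_measure.
Context {R : realType}.
Variables (f : R * R -> R * R) (mu : probability (R * R)%type R).
Hypothesis f_mu : Defs.invariant f mu.

Lemma measurable_iter n : measurable_fun setT (iter n f).
Proof.
elim: n => [|n IH]; first exact: measurable_id.
exact: measurableT_comp f_mu.1 IH.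
Qed.

Lemma iter_preimage_invariant n (B : set (R * R)) : measurable B ->
  mu (iter n f @^-1` B) = mu B.
Proof.
move=> mB; elim: n => // n IH; rewrite -IH.
have mnB : measurable (iter n f @^-1` B).
  by rewrite -[X in measurable X]setTI; exact: measurable_iter.
rewrite -(f_mu.2 _ mnB); congr (mu _); apply/seteqP.
by split => x; rewrite /= -iterSr.
Qed.

Lemma Rintegral_iter n A phi : bounded_measurable A phi ->
  \int[mu]_x phi (iter n f x) = \int[mu]_x phi x.
Proof.
move=> bphi; congr fine.
have mEphi : measurable_fun setT (EFin \o phi) by apply/measurable_EFinP; case: bphi.
have bphin := bounded_measurable_comp _ _ _ (measurable_iter n) bphi.
have := integral_pushforward (mu := mu) (measurable_iter n) mEphi
  (bounded_measurable_integrable _ _ _ bphin) measurableT.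
rewrite preimage_setT => <-; apply: eq_measure_integral => [|? B mB _].
  exact: measurable_iter.
exact: iter_preimage_invariant.
Qed.

(** By invariance the mean of [phi] is also that of [phi \o iter n f], so the bilinear calculus of
    [cov] applies. *)
Lemma correlationE n A phi psi : bounded_measurable A phi ->
  correlation f mu n phi psi = `|cov mu (phi \o iter n f) psi|.
Proof. by move=> bphi; rewrite /cov (Rintegral_iter _ _ _ bphi). Qed.

Lemma correlation_close A B r n phi phi' psi psi' :
  bounded_measurable A phi -> bounded_measurable A phi' ->
  bounded_measurable B psi -> bounded_measurable B psi' ->
  (forall x, `|phi x - phi' x| <= r) -> (forall x, `|psi x - psi' x| <= r) ->
  correlation f mu n phi psi <= correlation f mu n phi' psi' + 2 * (A + B) * r.
Proof.
move=> bphi bphi' bpsi bpsi' dphi dpsi.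
rewrite (correlationE _ _ _ _ bphi) (correlationE _ _ _ _ bphi').
have bn := bounded_measurable_comp _ _ _ (measurable_iter n).
rewrite -lerBlDl (le_trans (lerB_dist _ _))//.
by apply: cov_close => // [||x]; [exact: bn|exact: bn|exact: dphi].
Qed.

End invariant_measure.

(** * A decay constant uniform along a sequence of pairs *)

Section uniform_decay.
Context {R : realType}.
Variables (f : R * R -> R * R) (mu : probability (R * R)%type R).
Hypothesis f_mu : Defs.invariant f mu.
Variable tau : R.
Hypothesis tau0 : 0 <= tau.
Hypothesis decay : forall phi psi : R * R -> R, holder 1 phi -> holder 1 psi ->
  exists K : R, forall n, correlation f mu n phi psi <= K * tau ^+ n.

(* The constant of [decay] is made uniform along two sequences by applying
   [decay] to all subseries of their weighted sums: by Baire one constant serves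
   a whole cylinder of subseries, and the mixed second difference in the k-th
   digits isolates the pair [phi_ k, psi_ k]. *)
Lemma uniform_decay (theta M L : R) (phi_ psi_ : nat -> R * R -> R) :
  0 < theta < 1 ->
  (forall k x, `|phi_ k x| <= M) -> (forall k x, `|psi_ k x| <= M) ->
  (forall k, elipschitz (L / theta ^+ k) (phi_ k)) ->
  (forall k, elipschitz (L / theta ^+ k) (psi_ k)) ->
  exists (K : R) (N : nat), 0 <= K /\ forall k n, (N <= k)%N ->
    theta ^+ k ^+ 4 * correlation f mu n (phi_ k) (psi_ k) <= K * tau ^+ n.
Proof.
move=> theta01 bphi bpsi lphi lpsi.
have /andP[theta0 theta1] := theta01.
pose Phi (s : nat -> bool * bool) := subseries theta phi_ (fun k => (s k).1).
pose Psi (s : nat -> bool * bool) := subseries theta psi_ (fun k => (s k).2).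
pose B := M / (1 - theta).
have bPhi s : bounded_measurable B (Phi s).
  exact: subseries_bounded_measurable theta01 bphi lphi _.
have bPsi s : bounded_measurable B (Psi s).
  exact: subseries_bounded_measurable theta01 bpsi lpsi _.
(* [K] is a natural number, so that the sets are countably many; the strict inequality makes them
   open. *)
pose bad K s := exists n, K%:R * tau ^+ n < correlation f mu n (Phi s) (Psi s).
have bad_open K s : bad K s -> exists N, forall s',
    (forall i, (i < N)%N -> s' i = s i) -> bad K s'.
  (* [D * theta ^+ N] bounds the change of the correlation when only digits from [N] on vary; [N] is
     taken so large that this is below the gap in [hn]. *)
  move=> [n hn]; pose D := 2 * (B + B) * (M / (1 - theta)).
  have : (fun N => D * theta ^+ N) @ \oo --> 0.
    by apply: cvg_geometric; rewrite gtr0_norm.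
  move/cvgrPdist_lt => /(_ _ (etrans (subr_gt0 _ _) hn))[N _ /(_ N (leqnn N))].
  rewrite sub0r normrN => hN; exists N => s' s's; exists n.
  have close : correlation f mu n (Phi s) (Psi s) <=
      correlation f mu n (Phi s') (Psi s') +
      2 * (B + B) * (M * theta ^+ N / (1 - theta)).
    apply: (correlation_close _ _ f_mu) => // x.
    - by apply: subseries_close => // i iN; rewrite s's.
    - by apply: subseries_close => // i iN; rewrite s's.
  have := ler_norm (D * theta ^+ N).
  rewrite (_ : D * _ = 2 * (B + B) * (M * theta ^+ N / (1 - theta))) in hN *.
    lra.
  by rewrite /D; ring.
have not_bad s : exists K, ~ bad K s.
  have [||K hK] := decay (Phi s) (Psi s).
  - exact: elipschitz_holder1 (subseries_elipschitz _ _ _ _ theta01 bphi lphi _).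
  - exact: elipschitz_holder1 (subseries_elipschitz _ _ _ _ theta01 bpsi lpsi _).
  exists (Num.truncn K).+1 => -[n]; apply/negP; rewrite -leNgt.
  rewrite (le_trans (hK n))// ler_wpM2r ?exprn_ge0//.
  by rewrite ltW// truncnS_gt.
have [K [N [w hw]]] := cylinder_baire _ (false, false) _ bad_open not_bad.
(* The mixed second difference has four covariances, each bounded with the constant [K%:R]. The
   digits at [k] are free because [k] lies beyond the prefix of the cylinder. *)
exists (4 * K%:R), N; split => [|k n Nk]; first by rewrite mulr_ge0.
pose s b c i : bool * bool :=
  if (i < N)%N then w i else if i == k then (b, c) else (false, false).
have sk b c : s b c k = (b, c) by rewrite /s ltnNge Nk eqxx.
have sj b c j : j != k -> s b c j = s false false j.
  by rewrite /s => /negbTE ->.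
have good b c : correlation f mu n (Phi (s b c)) (Psi (s b c)) <= K%:R * tau ^+ n.
  rewrite leNgt; apply/negP => h; apply: (hw (s b c)); last by exists n.
  by move=> i iN; rewrite /s iN.
have Phi_fst b c c' : Phi (s b c) = Phi (s b c').
  rewrite /Phi; congr (subseries theta phi_); apply/funext => i.
  by have [->|ik] := eqVneq i k; rewrite ?sk// !(sj _ _ i ik).
have Psi_snd b b' c : Psi (s b c) = Psi (s b' c).
  rewrite /Psi; congr (subseries theta psi_); apply/funext => i.
  by have [->|ik] := eqVneq i k; rewrite ?sk// !(sj _ _ i ik).
pose t := theta ^+ k * theta ^+ k.
have flip_phi x : t * phi_ k x = Phi (s true false) x - Phi (s false false) x.
  by apply: (subseries_flip _ _ _ theta01 bphi); rewrite ?sk// => j /sj E; rewrite !E.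
have flip_psi x : t * psi_ k x = Psi (s false true) x - Psi (s false false) x.
  by apply: (subseries_flip _ _ _ theta01 bpsi); rewrite ?sk// => j /sj E; rewrite !E.
pose F b := Phi (s b false) \o iter n f; pose G c := Psi (s false c).
have bF b : bounded_measurable B (F b).
  exact: bounded_measurable_comp (measurable_iter _ _ f_mu n) (bPhi _).
have bG c : bounded_measurable B (G c) by exact: bPsi.
(* By [Phi_fst] and [Psi_snd] both factors come from the single sequence [s b c], so [good]
   applies. *)
have covFG b c : `|cov mu (F b) (G c)| <= K%:R * tau ^+ n.
  rewrite -(correlationE _ _ f_mu n _ _ _ (bPhi _)) /G (Psi_snd _ b).
  by rewrite (Phi_fst b false c).
have bphik : bounded_measurable M (phi_ k).
  split => //; apply: continuous_measurable_prod.
  exact: elipschitz_continuous (lphi k).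
have bpsik : bounded_measurable M (psi_ k).
  split => //; apply: continuous_measurable_prod.
  exact: elipschitz_continuous (lpsi k).
have bphikn := bounded_measurable_comp _ _ _ (measurable_iter _ _ f_mu n) bphik.
have tk0 : 0 <= theta ^+ k by rewrite exprn_ge0// ltW.
have t0 : 0 <= t by rewrite mulr_ge0.
rewrite (correlationE _ _ f_mu n _ _ _ bphik).
(* Each of the two flips contributes a weight [t], and [t * t] is [theta ^+ k ^+ 4]. *)
have -> : theta ^+ k ^+ 4 * `|cov mu (phi_ k \o iter n f) (psi_ k)| =
    `|cov mu (fun x => F true x - F false x) (fun x => G true x - G false x)|.
  rewrite (_ : (fun x => G true x - G false x) = fun x => t * psi_ k x); last first.
    by apply/funext => x; rewrite flip_psi.
  rewrite (_ : (fun x => F true x - F false x) =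
      fun x => t * (phi_ k \o iter n f) x); last first.
    by apply/funext => x /=; rewrite flip_phi.
  rewrite (covZl _ _ _ _ _ _ bphikn (bounded_measurableZ _ _ _ bpsik)).
  rewrite (covZr _ _ _ _ _ _ bphikn bpsik) !normrM ger0_norm//.
  by rewrite /t; ring.
rewrite (covBr mu _ _ _ _ _ _ (bounded_measurableB _ _ _ _ (bF true) (bF false)) (bG true) (bG false)).
rewrite !(covBl _ _ _ _ _ _ _ (bF true) (bF false) (bG _)).
have := covFG true true; have := covFG true false.
have := covFG false true; have := covFG false false.
rewrite !ler_norml => /andP[? ?] /andP[? ?] /andP[? ?] /andP[? ?].
by apply/andP; split; lra.
Qed.

End uniform_decay.

(** * Moduli of continuity and sup norms *)

Section modulus.
Context {R : realType}.
Implicit Types (phi psi : R * R -> R) (e r : R).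

Lemma edist_midpoint (x y : R * R) :
  let m := ((x.1 + y.1) / 2, (x.2 + y.2) / 2) in
  edist x m = edist x y / 2 /\ edist m y = edist x y / 2.
Proof.
have sqrt4 (a b c d : R) : a = c / 2 -> b = d / 2 ->
    Num.sqrt (a ^+ 2 + b ^+ 2) = Num.sqrt (c ^+ 2 + d ^+ 2) / 2.
  move=> -> ->; apply/eqP.
  rewrite -(@eqrXn2 _ 2)// ?divr_ge0 ?sqrtr_ge0// [eqbRHS]expr_div_n.
  by rewrite !sqr_sqrtr ?addr_ge0 ?sqr_ge0//; apply/eqP; field.
by split; apply: sqrt4 => /=; field.
Qed.

Lemma modulus_le phi e x y : edist x y < e ->
  (`|phi x - phi y|%:E <= modulus phi e)%E.
Proof. by move=> xy; apply: ereal_sup_ubound; exists (x, y). Qed.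

Lemma modulus_ge0 phi e : 0 < e -> (0 <= modulus phi e)%E.
Proof.
move=> e0; apply: le_trans (modulus_le phi e 0 0 _); first by rewrite lee_fin.
by rewrite edistxx.
Qed.

(** Passing through midpoints doubles the distance below which values agree, and finitely many
    doublings reach any pair of points. *)
Lemma modulus_eq0_const phi e : 0 < e -> modulus phi e = 0%E ->
  forall x y, phi x = phi y.
Proof.
move=> e0 mod0 x y.
have near_eq n : forall x y, edist x y < e * 2 ^+ n -> phi x = phi y.
  elim: n => [|n IH] {}x {}y xy.
    rewrite expr0 mulr1 in xy; apply/eqP; rewrite -subr_eq0 -normr_le0 -lee_fin.
    by apply: le_trans (modulus_le phi e x y xy) _; rewrite mod0.
  have [xm my] := edist_midpoint x y.
  have half : edist x y / 2 < e * 2 ^+ n.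
    by rewrite ltr_pdivrMr// -mulrA -exprSr.
  by rewrite -xm in half; rewrite (IH _ _ half); apply: IH; rewrite my -xm.
apply: (near_eq (Num.truncn (edist x y / e)).+1).
rewrite mulrC -ltr_pdivrMr//; apply: (lt_trans (truncnS_gt _)).
by rewrite -natrX ltr_nat ltn_expl.
Qed.

Lemma sup_norm_ge phi x : (`|phi x|%:E <= sup_norm phi)%E.
Proof. by apply: ereal_sup_ubound; exists x. Qed.

Lemma sup_norm_ge0 phi : (0 <= sup_norm phi)%E.
Proof. by apply: le_trans (sup_norm_ge phi 0); rewrite lee_fin. Qed.

Lemma sup_norm_le phi (M : R) : (forall x, `|phi x| <= M) -> (sup_norm phi <= M%:E)%E.
Proof. by move=> h; apply: ge_ereal_sup => _ [x _ <-]; rewrite lee_fin. Qed.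

(** In [\bar R] the product [0 * +oo] is [0]; strict positivity is what makes the bound infinite for
    an unbounded observable. *)
Lemma modulus_gt0 phi e : 0 < e -> sup_norm phi = +oo%E -> (0 < modulus phi e)%E.
Proof.
move=> e0 phioo; rewrite lt_def modulus_ge0// andbT; apply/eqP => /modulus_eq0_const.
move=> /(_ e0) cphi; have : (sup_norm phi <= `|phi 0|%:E)%E.
  by apply: sup_norm_le => x; rewrite (cphi x 0).
by rewrite phioo.
Qed.

End modulus.

(** * Decay for bounded continuous observables *)

Section continuous_observables.
Context {R : realType}.
Variables (f : R * R -> R * R) (mu : probability (R * R)%type R).
Hypothesis f_mu : Defs.invariant f mu.
Hypothesis f_decay : holder_exp_decay f mu.

(* Regularising at scale [theta ^+ n] costs a factor [theta ^- (4 * n)], which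
   the rate [tau = theta ^+ 5] pays for. *)
Lemma continuous_decay : exists theta : R, 0 < theta < 1 /\
  forall (phi psi : R * R -> R) (M1 M2 : R), continuous phi -> continuous psi ->
  (forall x, `|phi x| <= M1) -> (forall x, `|psi x| <= M2) ->
  exists C, forall n r,
    (forall x y, edist x y < theta ^+ n -> `|phi x - phi y| <= r) ->
    (forall x y, edist x y < theta ^+ n -> `|psi x - psi y| <= r) ->
    correlation f mu n phi psi <= 2 * (M1 + M2) * r + C * theta ^+ n.
Proof.
have [|tau [/andP[tau0 tau1] decay]] := f_decay 1; first by rewrite ltr01 lexx.
pose theta := tau `^ 5^-1.
have theta0 : 0 < theta by rewrite powR_gt0.
have theta5 : theta ^+ 5 = tau.
  by rewrite -powR_mulrn ?powR_ge0// -powRrM mulVf// powRr1// ltW.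
have theta1 : theta < 1.
  rewrite ltNge; apply/negP => /(exprn_ege1 5).
  by rewrite theta5 leNgt tau1.
have theta01 : 0 < theta < 1 by rewrite theta0.
have thetaX k : 0 < theta ^+ k by rewrite exprn_gt0.
exists theta; split => // phi psi M1 M2 cphi cpsi bphi bpsi.
have M10 : 0 <= M1 by exact: le_trans (bphi 0).
have M20 : 0 <= M2 by exact: le_trans (bpsi 0).
have [phi_ phi_P] := choice (fun k => lipschitz_approximation _ _ _ (thetaX k) bphi).
have [psi_ psi_P] := choice (fun k => lipschitz_approximation _ _ _ (thetaX k) bpsi).
have bm (M L : R) (h : R * R -> R) : elipschitz L h -> (forall x, `|h x| <= M) ->
    bounded_measurable M h.
  move=> lh bh; split => //; apply: continuous_measurable_prod.
  exact: elipschitz_continuous lh.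
(* A common bound, since [uniform_decay] takes one [M] and one [L] for both sequences. *)
pose M := M1 + M2.
have lipM (c : R) k h : c <= M -> elipschitz (2 * c / theta ^+ k) h ->
    elipschitz (2 * M / theta ^+ k) h.
  move=> cM lh x y; apply: (le_trans (lh x y)); rewrite ler_wpM2r ?edist_ge0//.
  by rewrite ler_wpM2r ?invr_ge0 ?(ltW (thetaX k))// ler_wpM2l.
have [||||K [N [K0 hK]]] := uniform_decay _ _ f_mu tau (ltW tau0) decay
    theta M (2 * M) phi_ psi_ theta01.
- move=> k x; have [h _ _] := phi_P k.
  by rewrite (le_trans (h x))// lerDl.
- move=> k x; have [h _ _] := psi_P k.
  by rewrite (le_trans (h x))// lerDr.
- by move=> k; have [_ h _] := phi_P k; apply: lipM h; rewrite lerDl.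
- by move=> k; have [_ h _] := psi_P k; apply: lipM h; rewrite lerDr.
(* [K] serves the times [n >= N]. For [n < N] the trivial bound [2 * M1 * M2] suffices, as
   [theta ^+ n / theta ^+ N] is at least 1. *)
exists (K + 2 * M1 * M2 / theta ^+ N) => n r rphi rpsi.
have [bphin lphin /(_ _ rphi) dphi] := phi_P n.
have [bpsin lpsin /(_ _ rpsi) dpsi] := psi_P n.
have bmphi : bounded_measurable M1 phi.
  by split => //; exact: continuous_measurable_prod.
have bmpsi : bounded_measurable M2 psi.
  by split => //; exact: continuous_measurable_prod.
have bmphin := bm _ _ _ lphin bphin; have bmpsin := bm _ _ _ lpsin bpsin.
apply: (le_trans (correlation_close _ _ f_mu _ _ _ n _ _ _ _
  bmphi bmphin bmpsi bmpsin dphi dpsi)).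
rewrite addrC lerD2l mulrDl; have [Nn|nN] := leqP N n.
  apply: (@le_trans _ _ (K * theta ^+ n)); last first.
    by rewrite lerDl mulr_ge0 ?divr_ge0 ?mulr_ge0// ltW.
  have := hK n n Nn; rewrite -ler_pdivlMl ?exprn_gt0// => /le_trans; apply.
  rewrite -theta5 (_ : theta ^+ 5 ^+ n = theta ^+ n ^+ 4 * theta ^+ n); last first.
    by rewrite -exprM mulnC exprM exprSr.
  by rewrite mulrCA mulKf// expf_neq0// gt_eqF.
apply: (@le_trans _ _ (2 * M1 * M2 / theta ^+ N * theta ^+ n)); last first.
  by rewrite lerDr mulr_ge0// ltW.
apply: (@le_trans _ _ (2 * M1 * M2)).
  rewrite (correlationE _ _ f_mu _ _ _ _ bmphin); apply: normr_cov_le => //.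
  exact: bounded_measurable_comp (measurable_iter _ _ f_mu n) bmphin.
rewrite -[leRHS]mulrA ler_peMr ?mulr_ge0// ler_pdivlMl// mulr1.
by rewrite ler_wiXn2l ?(ltW theta0) ?(ltW theta1)// ltnW.
Qed.

End continuous_observables.

(** * The Hénon map *)

Theorem theorem2p1 (R : realType) (A : set (R * R))
    (hA : benedicks_young_parameters A) (a b : R) (hab : A (a, b))
    (mu : probability (R * R)%type R) (hmu : SRB (henon a b) mu) :
  exists theta : R, 0 < theta < 1 /\
    forall phi psi : R * R -> R, continuous phi -> continuous psi ->
    exists C : R, forall n : nat,
      ((correlation (henon a b) mu n phi psi)%:E <=
         2%:E * (sup_norm phi + sup_norm psi) * modulus2 phi psi (theta ^+ n)
         + (C * theta ^+ n)%:E)%E.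
Proof.
have [_ _ /(_ _ hmu)[_ _ f_decay]] := hA.2 a b hab.
have [f_mu _ _ _] := hmu.
have [theta [theta01 htheta]] := continuous_decay _ _ f_mu f_decay.
have thetaX n : 0 < theta ^+ n by rewrite exprn_gt0//; case/andP: theta01.
exists theta; split => // phi psi cphi cpsi.
have [/andP[phifin psifin]|infinite] :=
  boolP ((sup_norm phi \is a fin_num) && (sup_norm psi \is a fin_num)); last first.
  have [phioo|psioo] : sup_norm phi = +oo%E \/ sup_norm psi = +oo%E.
    move: infinite; rewrite negb_and !ge0_fin_numE ?sup_norm_ge0//.
    by rewrite -!leNgt !leye_eq => /orP[] /eqP; [left|right].
  (* The right-hand side is infinite, so any constant will do. *)
  - exists 0 => n; rewrite phioo addye; last first.
      by rewrite gt_eqF// (lt_le_trans _ (sup_norm_ge0 psi))// ltNye.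
    rewrite mulry gtr0_sg// mul1e gt0_mulye ?leey//.
    by rewrite lt_max (modulus_gt0 _ _ (thetaX n) phioo).
  - exists 0 => n; rewrite psioo addey; last first.
      by rewrite gt_eqF// (lt_le_trans _ (sup_norm_ge0 phi))// ltNye.
    rewrite mulry gtr0_sg// mul1e gt0_mulye ?leey//.
    by rewrite lt_max (modulus_gt0 _ _ (thetaX n) psioo) orbT.
have bphi x : `|phi x| <= fine (sup_norm phi).
  by rewrite -lee_fin fineK// sup_norm_ge.
have bpsi x : `|psi x| <= fine (sup_norm psi).
  by rewrite -lee_fin fineK// sup_norm_ge.
have [C hC] := htheta _ _ _ _ cphi cpsi bphi bpsi.
exists C => n.
(* The modulus is at most twice the sup norm; all terms being finite, the inequality descends to the
   reals. *)
have modulus_fin h : sup_norm h \is a fin_num ->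
    modulus h (theta ^+ n) \is a fin_num.
  move=> hfin; rewrite ge0_fin_numE ?modulus_ge0//.
  apply: (@le_lt_trans _ _ (sup_norm h + sup_norm h)%E); last first.
    by rewrite lte_add_pinfty// ltey_eq hfin.
  apply: ge_ereal_sup => _ [p _ <-].
  apply: (@le_trans _ _ (`|h p.1| + `|h p.2|)%:E).
    by rewrite lee_fin ler_normB.
  by rewrite EFinD leeD// sup_norm_ge.
have fin2 : modulus2 phi psi (theta ^+ n) \is a fin_num.
  by rewrite /modulus2 maxEle; case: ifP => _; exact: modulus_fin.
rewrite -(fineK fin2) -(fineK phifin) -(fineK psifin) -EFinD lee_fin.
apply: hC => x y xy; rewrite -lee_fin fineK// le_max modulus_le ?orbT//.
Qed.
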